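(* For $\alpha,\beta>0$ let $\Phi^{\alpha,\beta}:=\Psi+\Phi_{ch}^{\alpha,\beta}$ be a function on $\mathcal M_{N,K}$, where $\Psi:\mathcal M_{N,K}\to[0,\infty)$ is any real analytic function that does not depend on the parameters $\alpha$ or $\beta$. Let $G\in\mathcal M_{N,K}$ be equal-norm with no zero entries, fix $\alpha\in(0,\infty)$, and suppose that $\nabla\Phi^{\alpha,\beta}(G)=0$ for all $\beta\in J$, where $J\subseteq(0,\infty)$ is an open interval. Then $G$ is $\alpha$-equipartitioned.
   Context: Let $\mathbb F=\mathbb R$ or $\mathbb C$ and let $1\le K\le N$ be integers. $\mathcal M_{N,K}=\{G\in\mathbb F^{N\times N}: G=G^2=G^*,\ \mathrm{tr}(G)=K\}$, regarded as a real analytic submanifold of the Hermitian (resp. symmetric) matrices with the Riemannian metric $X\cdot Y=\mathrm{tr}(XY)$; $\nabla$ is the corresponding Riemannian gradient on $\mathcal M_{N,K}$. $G$ is equal-norm if all its diagonal entries are equal. Indices lie in $\mathbb Z_N$ (so $x+1$ is taken modulo $N$). Open intervals are nonempty. For $x\in\mathbb Z_N$, $\alpha,\beta>0$ the exponential row sum potential is $R_x^{\alpha,\beta}(G)=\frac1\alpha\sum_{j\ne x}e^{\alpha|G_{x,j}|^2}+\beta e^{|G_{x,x}|^2}$, and the chain potential is $\Phi_{ch}^{\alpha,\beta}(G)=\sum_{x\in\mathbb Z_N}\left(R_x^{\alpha,\beta}(G)-R_{x+1}^{\alpha,\beta}(G)\right)^2$. $G$ is $\alpha$-equipartitioned if $\sum_{j\in\mathbb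 Z_N}e^{\alpha|G_{x,j}|^2}=\sum_{j\in\mathbb Z_N}e^{\alpha|G_{y,j}|^2}$ for all $x,y\in\mathbb Z_N$. *)

(* Defs.v *)
From HB Require Import structures.
From mathcomp Require Import all_boot all_order all_algebra finmap.
From mathcomp Require Import all_classical all_reals all_analysis.
From mathcomp Require Import summability spectral.
From mathcomp Require Export complex.
Set Implicit Arguments.
Unset Strict Implicit.
Unset Printing Implicit Defensive.
Import Order.TTheory GRing.Theory Num.Theory numFieldNormedType.Exports.
Local Open Scope classical_set_scope.
Local Open Scope ring_scope.
Local Open Scope complex_scope.
Local Open Scope sesquilinear_scope.

(* The field is a parameter.  Matrices over the reals are the matrices over
   R[i] all of whose entries are real. *)
Inductive base_field := RealField | ComplexField.

Definition mx_over (R : realType) (F : base_field) (N : nat)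
    (G : 'M[R[i]]_N) : Prop :=
  match F with
  | RealField => forall i j, complex.Im (G i j) = 0
  | ComplexField => True
  end.

(* Rank K orthogonal projections over the base field. *)
Definition grassmannian (R : realType) (F : base_field) (N K : nat) :
    set 'M[R[i]]_N :=
  [set G | [/\ mx_over F G, G = G *m G, G = G ^t* & \tr G = K%:R]].

(* Real coordinates of a matrix: (i, j, false) is the real part of the (i, j)
   entry and (i, j, true) its imaginary part. *)
Definition coord (R : realType) (N : nat) (G : 'M[R[i]]_N)
    (k : 'I_N * 'I_N * bool) : R :=
  if k.2 then complex.Im (G k.1.1 k.1.2) else complex.Re (G k.1.1 k.1.2).

(* Sum of a power series in the real coordinates of X.  Convergence is along
   the finite sets of multi-indices ordered by inclusion, that is, absolute
   convergence. *)
Definition is_power_series_sum (R : realType) (N : nat)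
    (c : {ffun 'I_N * 'I_N * bool -> nat} -> R) (X : 'M[R[i]]_N) (s : R) :
    Prop :=
  partial_sum (fun a => c a * \prod_k coord X k ^+ a k) @ totally --> s.

Definition analytic_at (R : realType) (N : nat) (f : 'M[R[i]]_N -> R)
    (G : 'M[R[i]]_N) : Prop :=
  exists c, exists2 r : R, 0 < r &
    forall H, (forall k, `|coord (H - G) k| < r) ->
      is_power_series_sum c (H - G) (f H).

(* Functions on an embedded submanifold M are represented by functions on all
   matrices, whose values outside M are irrelevant.  Such a function is real
   analytic on M if near each point of M it coincides on M with an ambient real
   analytic function. *)
Definition real_analytic_on (R : realType) (N : nat) (M : set 'M[R[i]]_N)
    (f : 'M[R[i]]_N -> R) : Prop :=
  forall G, M G ->
    exists g : 'M[R[i]]_N -> R, analytic_at g G /\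
      exists2 r : R, 0 < r &
        forall H, M H -> (forall k, `|coord (H - G) k| < r) -> f H = g H.

(* The curve g lies in M near time 0, passes through G at time 0 and has
   velocity X there. *)
Definition curve_with_velocity (R : realType) (N : nat) (M : set 'M[R[i]]_N)
    (G : 'M[R[i]]_N) (g : R -> 'M[R[i]]_N) (X : 'M[R[i]]_N) : Prop :=
  [/\ g 0 = G, \forall t \near (0 : R), M (g t) &
    forall k, is_derive (0 : R) 1 (fun t => coord (g t) k) (coord X k)].

Definition tangent_space (R : realType) (N : nat) (M : set 'M[R[i]]_N)
    (G : 'M[R[i]]_N) : set 'M[R[i]]_N :=
  [set X | exists g, curve_with_velocity M G g X].

(* tr (X Y) is real for Hermitian X and Y, so nothing is lost by Re. *)
Definition riem_metric (R : realType) (N : nat) (X Y : 'M[R[i]]_N) : R :=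
  complex.Re (\tr (X *m Y)).

(* V is the Riemannian gradient at G of the restriction of f to M. *)
Definition is_gradient (R : realType) (N : nat) (M : set 'M[R[i]]_N)
    (f : 'M[R[i]]_N -> R) (G V : 'M[R[i]]_N) : Prop :=
  tangent_space M G V /\
  forall g X, curve_with_velocity M G g X ->
    is_derive (0 : R) 1 (fun t => f (g t)) (riem_metric V X).

Definition sqmod (R : realType) (z : R[i]) : R := Normc.normc z ^+ 2.

Definition row_sum (R : realType) (N : nat) (alpha beta : R)
    (G : 'M[R[i]]_N) (x : 'I_N) : R :=
  alpha^-1 * (\sum_(j < N | j != x) expR (alpha * sqmod (G x j)))
  + beta * expR (sqmod (G x x)).

(* ordS x is x + 1 modulo N. *)
Definition chain_potential (R : realType) (N : nat) (alpha beta : R)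
    (G : 'M[R[i]]_N) : R :=
  \sum_(x < N)
    (row_sum alpha beta G x - row_sum alpha beta G (ordS x)) ^+ 2.

Definition equal_norm (R : realType) (N : nat) (G : 'M[R[i]]_N) : Prop :=
  forall x y : 'I_N, G x x = G y y.

Definition equipartitioned (R : realType) (N : nat) (alpha : R)
    (G : 'M[R[i]]_N) : Prop :=
  forall x y : 'I_N,
    \sum_(j < N) expR (alpha * sqmod (G x j)) =
    \sum_(j < N) expR (alpha * sqmod (G y j)).

(* Main.v *)
Require Import Defs.
From mathcomp Require Import all_boot all_order all_algebra.
From mathcomp Require Import all_classical all_reals all_analysis.
From mathcomp Require Import spectral ring.
Set Implicit Arguments.
Unset Strict Implicit.
Unset Printing Implicit Defensive.
Import Order.TTheory GRing.Theory Num.Theory numFieldNormedType.Exports.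
Local Open Scope classical_set_scope.
Local Open Scope ring_scope.
Local Open Scope complex_scope.
Local Open Scope sesquilinear_scope.

(** The values of [Psi] along a curve in the manifold do not involve beta, so
    subtracting the vanishing derivatives for two values of beta in [J] leaves
    only the chain potential.  Write the difference of consecutive row sums as
    p_x + beta q_x, where p_x comes from the off-diagonal entries
    and q_x from the diagonal ones.  At an equal-norm [G] all q_x vanish, so the
    derivative of the chain potential is affine in beta and its slope is a
    multiple of sum_x p_x q_x'.  Hence this sum is zero
    ([critical_affine_squares]).  The diagonal of [G] is a nonzero constant, so
    q_x' is a fixed nonzero multiple of X_xx - X_(x+1,x+1), for X the velocity of
    the curve ([critical_along_curve]).

    It remains to have enough curves.  Conjugating [G] by the one-parameter group
    of rotations mixing the coordinates x and y, with the phase chosen according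
    to [G x y] != 0, gives a curve in the manifold whose velocity has a nonzero
    diagonal, proportional to the indicator of x minus that of y
    ([pair_rotation]).  Inserting it yields
    p_x - p_(x-1) = p_y - p_(y-1) for all x, y.  A function on a cycle with
    constant increments is constant because its increments add up to zero
    ([const_of_cyclic_diff]): so p is constant, and then, p being itself the
    increment of the off-diagonal sums, these are constant as well.  As the
    diagonal entries agree, the full exponential row sums agree. *)

Local Notation coord := Defs.coord.

(** * Functions on a cycle *)

(** Once around the cycle the increments telescope to zero, so their common value
    is zero. *)
Lemma const_of_cyclic_diff (R : numDomainType) (N : nat) (f : 'I_N -> R) :
  (forall x y, f x - f (ordS x) = f y - f (ordS y)) -> forall x y, f x = f y.
Proof.
move=> hf x0; pose c := f x0 - f (ordS x0).
have hc x : f x - f (ordS x) = c by exact: hf.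
have c0 (x : 'I_N) : c = 0.
  have : \sum_(x < N) (f x - f (ordS x)) = 0.
    rewrite sumrB [X in _ - X](_ : _ = \sum_(x < N) f x) ?subrr//.
    by rewrite [RHS](reindex _ (onW_bij _ (@ordS_bij N))).
  rewrite (eq_bigr _ (fun x _ => hc x)) sumr_const card_ord => /eqP.
  rewrite mulrn_eq0 => /orP[/eqP N0|/eqP//].
  by have := ltn_ord x; rewrite [X in (_ < X)%N]N0.
have step x : f (ordS x) = f x by apply/esym/eqP; rewrite -subr_eq0 hc (c0 x0).
suff key (k : nat) (hk : (k < N)%N) (h0 : (0 < N)%N) :
    f (Ordinal hk) = f (Ordinal h0).
  have h0 : (0 < N)%N := leq_ltn_trans (leq0n x0) (ltn_ord x0).
  have e z : f z = f (Ordinal h0) by case: z => z hz; exact: key.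
  by move=> y; rewrite !e.
elim: k hk => [|k IH] hk; first by congr f; apply/val_inj.
rewrite -(IH (ltnW hk)) -(step (Ordinal (ltnW hk))); congr f; apply/val_inj => /=.
by rewrite modn_small.
Qed.

(** * Curves of matrices and their velocities *)

Section Curves.
Variables (R : realType) (N : nat).
Implicit Types (A B : R -> 'M[R[i]]_N) (X Y G S : 'M[R[i]]_N).

Definition has_velocity A X :=
  forall k, is_derive (0 : R) 1 (fun t => coord (A t) k) (coord X k).

Lemma has_velocity_cst G : has_velocity (fun=> G) 0.
Proof.
move=> k; rewrite [coord 0 k](_ : _ = 0); first exact: is_derive_cst.
by rewrite /coord; case: k.2; rewrite mxE.
Qed.

Lemma coordD X Y k : coord (X + Y) k = coord X k + coord Y k.
Proof.
by rewrite /coord mxE; case: (X _ _) => a b; case: (Y _ _) => c d; case: k.2.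
Qed.

Lemma coordZ (a : R) X k : coord (a%:C *: X) k = a * coord X k.
Proof.
rewrite /coord mxE; case: (X _ _) => b c; case: k.2; rewrite /= mul0r.
  by rewrite addr0.
by rewrite subr0.
Qed.

Lemma has_velocityD A B X Y : has_velocity A X -> has_velocity B Y ->
  has_velocity (fun t => A t + B t) (X + Y).
Proof.
move=> hA hB k; rewrite coordD.
under eq_fun do rewrite coordD.
exact: is_deriveD.
Qed.

Lemma has_velocityZ (f : R -> R) (df : R) X : is_derive (0 : R) 1 f df ->
  has_velocity (fun t => (f t)%:C *: X) (df%:C *: X).
Proof.
move=> hf k; rewrite coordZ.
under eq_fun do rewrite coordZ mulrC.
rewrite mulrC; exact: is_deriveZ.
Qed.

Lemma coordM X Y k : coord (X *m Y) k = \sum_j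
  (if k.2 then
     coord X (k.1.1, j, false) * coord Y (j, k.1.2, true)
     + coord X (k.1.1, j, true) * coord Y (j, k.1.2, false)
   else
     coord X (k.1.1, j, false) * coord Y (j, k.1.2, false)
     - coord X (k.1.1, j, true) * coord Y (j, k.1.2, true)).
Proof.
have ReD := big_morph (@complex.Re R) (id1 := 0) (op1 := +%R).
have ImD := big_morph (@complex.Im R) (id1 := 0) (op1 := +%R).
rewrite /coord mxE /=; case: k.2.
  rewrite (ImD 0 +%R)//; last by move=> [a b] [c d].
  by apply: eq_bigr => j _; case: (X _ _) => a b; case: (Y _ _) => c d.
rewrite (ReD 0 +%R)//; last by move=> [a b] [c d].
by apply: eq_bigr => j _; case: (X _ _) => a b; case: (Y _ _) => c d.
Qed.

Lemma has_velocityM A B X Y : has_velocity A X -> has_velocity B Y ->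
  has_velocity (fun t => A t *m B t) (X *m B 0 + A 0 *m Y).
Proof.
move=> hA hB k; rewrite coordD !coordM -big_split /=.
under eq_fun do rewrite coordM.
rewrite -fct_sumE; apply: is_derive_sum => j.
have hM b c := is_deriveM (hA (k.1.1, j, b)) (hB (j, k.1.2, c)).
case: k.2.
  apply: is_derive_eq (is_deriveD (hM false true) (hM true false)) _.
  by rewrite /GRing.scale /=; ring.
apply: is_derive_eq (is_deriveB (hM false false) (hM true true)) _.
by rewrite /GRing.scale /=; ring.
Qed.

(** Rodrigues' formula: this is exp (t S) as soon as S ^ 3 = - S, and for such S
    that are skew-Hermitian it gives one-parameter groups of unitary matrices
    without the matrix exponential. *)
Definition rodrigues S (t : R) : 'M[R[i]]_N :=
  1%:M + (sin t)%:C *: S + (1 - cos t)%:C *: (S *m S).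

Lemma rodrigues0 S : rodrigues S 0 = 1%:M.
Proof. by rewrite /rodrigues sin0 cos0 subrr !scale0r !addr0. Qed.

Lemma has_velocity_rodrigues S : has_velocity (rodrigues S) S.
Proof.
have eS : 0 + 1%:C *: S + 0%:C *: (S *m S) = S.
  by rewrite add0r scale1r scale0r addr0.
rewrite -[X in has_velocity _ X]eS.
apply: has_velocityD; last first.
  apply: has_velocityZ; apply: is_derive_eq.
  by rewrite sin0 !oppr0 mulr0.
apply: has_velocityD; first exact: has_velocity_cst.
by apply: has_velocityZ; apply: is_derive_eq; rewrite cos0.
Qed.

Lemma adjointM X Y : (X *m Y) ^t* = Y ^t* *m X ^t*.
Proof. by rewrite trmx_mul map_mxM. Qed.

Lemma adjoint_rodrigues S t : (rodrigues S t) ^t* = rodrigues (S ^t*) t.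
Proof.
have adjD (X Y : 'M[R[i]]_N) : (X + Y) ^t* = X ^t* + Y ^t* by rewrite linearD map_mxD.
have adjZ (a : R) (X : 'M[R[i]]_N) : (a%:C *: X) ^t* = a%:C *: X ^t*.
  by rewrite linearZ map_mxZ; congr (_ *: _); exact: conjc_real.
by rewrite /rodrigues !adjD !adjZ adjointM trmx1 map_mx1.
Qed.

(** With P = S ^ 2 one has S P = - S and P ^ 2 = - P, so only a multiple of P is
    left besides the identity, and its coefficient vanishes by
    cos ^ 2 + sin ^ 2 = 1. *)
Lemma rodriguesN S t : S *m S *m S = - S ->
  rodrigues (- S) t *m rodrigues S t = 1%:M.
Proof.
move=> S3; set s := (sin t)%:C; set e := (1 - cos t)%:C.
have se : e *+ 2 - s * s - e * e = 0.
  rewrite /s /e -!rmorphM -rmorphMn -!rmorphB /=.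
  rewrite [X in X%:C](_ : _ = 1 - (cos t ^+ 2 + sin t ^+ 2)); last by ring.
  by rewrite cos2Dsin2 subrr.
rewrite /rodrigues -/s -/e mulNmx mulmxN opprK scalerN.
have S4 : S *m S *m (S *m S) = - (S *m S) by rewrite mulmxA S3 mulNmx.
rewrite !(mulmxDl, mulmxDr, mulNmx, mulmxN, mul1mx, mulmx1).
rewrite -!scalemxAl -!scalemxAr S4 mulmxA S3 !scalerN !scalerA.
transitivity (1%:M + (e *+ 2 - s * s - e * e) *: (S *m S)).
  move: (S *m S) => P; apply/matrixP=> i j; rewrite !mxE; ring.
by rewrite se scale0r addr0.
Qed.

End Curves.

(** * Curves in the Grassmannian *)

Section Grassmannian.
Variables (R : realType) (F : base_field) (N K : nat).
Implicit Types (G U S : 'M[R[i]]_N).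

Lemma mx_over1 : mx_over F (1%:M : 'M[R[i]]_N).
Proof. by case: F => //= i j; rewrite mxE; case: (_ == _). Qed.

Lemma mx_overD G U : mx_over F G -> mx_over F U -> mx_over F (G + U).
Proof.
case: F => //= hG hU i j; have := coordD G U (i, j, true).
by rewrite /coord /= => ->; rewrite hG hU addr0.
Qed.

Lemma mx_overZ (a : R) G : mx_over F G -> mx_over F (a%:C *: G).
Proof.
case: F => //= hG i j; have := coordZ a G (i, j, true).
by rewrite /coord /= => ->; rewrite hG mulr0.
Qed.

Lemma mx_overM G U : mx_over F G -> mx_over F U -> mx_over F (G *m U).
Proof.
case: F => //= hG hU i j; have := coordM G U (i, j, true).
rewrite /coord /= => ->; apply: big1 => k _.
by rewrite hG hU mulr0 mul0r addr0.
Qed.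

Lemma mx_over_rodrigues S t : mx_over F S -> mx_over F (rodrigues S t).
Proof.
move=> hS; rewrite /rodrigues.
by apply: mx_overD; [apply: mx_overD|];
  [exact: mx_over1|exact: mx_overZ|exact/mx_overZ/mx_overM].
Qed.

Lemma mx_overN G : mx_over F G -> mx_over F (- G).
Proof. by move=> /(mx_overZ (-1)); rewrite rmorphN1 scaleN1r. Qed.

Lemma grassmannian_conj G U V : mx_over F U -> mx_over F V -> V = U ^t* ->
  V *m U = 1%:M -> grassmannian F K G -> grassmannian F K (U *m G *m V).
Proof.
move=> FU FV VE VU [FG G2 GE trG]; split.
- by do 2![apply: mx_overM => //].
- by rewrite !mulmxA -[U *m G *m V *m U]mulmxA VU mulmx1 -[U *m G *m G]mulmxA -G2.
- by rewrite !adjointM -VE -GE VE trmxCK mulmxA.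
- by rewrite mxtrace_mulC mulmxA VU mul1mx.
Qed.

(** The curve is the conjugation orbit t |-> exp (t S) G exp (- t S), which stays
    in the manifold because exp (t S) is unitary over the base field. *)
Lemma curve_commutator G S : grassmannian F K G -> mx_over F S ->
  S ^t* = - S -> S *m S *m S = - S ->
  exists g, curve_with_velocity (grassmannian F K) G g (S *m G - G *m S).
Proof.
move=> hG FS SE S3; exists (fun t => rodrigues S t *m G *m rodrigues (- S) t).
split.
- by rewrite !rodrigues0 mul1mx mulmx1.
- apply: filterE => t; apply: grassmannian_conj => //.
  + exact: mx_over_rodrigues.
  + exact/mx_over_rodrigues/mx_overN.
  + by rewrite adjoint_rodrigues SE.
  + exact: rodriguesN.
- have hV := has_velocityM (has_velocityM (has_velocity_rodrigues S)
    (has_velocity_cst G)) (has_velocity_rodrigues (- S)).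
  by move: hV; rewrite !rodrigues0 !mul1mx !mulmx1 addr0 mulmxN.
Qed.

(** Rotation in the plane of the basis vectors x and y.  The generator is
    S = w E_xy - conj w E_yx with w the phase of [G x y]: the x-th diagonal entry
    of S G - G S is then 2 Re (w G_yx) = 2 |G x y|, the y-th one is the opposite,
    and the others vanish. *)
Lemma pair_rotation G (x y : 'I_N) : grassmannian F K G -> x != y ->
  G x y != 0 ->
  exists g X (c : R), [/\ c != 0,
    curve_with_velocity (grassmannian F K) G g X &
    forall z, complex.Re (X z z) = c * ((z == x)%:R - (z == y)%:R)].
Proof.
move=> hG xy Gxy; have [FG G2 GE trG] := hG.
pose r := `|G x y|; pose w := G x y / r; pose w' := Num.conj w.
have Gyx : G y x = Num.conj (G x y) by rewrite [in LHS]GE !mxE.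
have r0 : r != 0 by rewrite normr_eq0.
have rr : Num.conj r = r by apply/CrealP; exact: normr_real.
have GG : G x y * G y x = r ^+ 2 by rewrite Gyx normCK.
have w'E : w' = G y x / r by rewrite /w' /w rmorphM fmorphV Gyx /= rr.
have wG : w * G y x = r.
  by rewrite /w mulrAC GG expr2 mulfK.
have w'G : w' * G x y = r by rewrite w'E mulrAC [G y x * _]mulrC GG expr2 mulfK.
have ww : w * w' = 1 by rewrite w'E mulrA wG divff.
have Cw' : Num.conj w' = w by rewrite conjCK.
have Cw : Num.conj w = w' by [].
have rR : r \is Num.real := normr_real _.
have rN : (Normc.normc (G x y))%:C = r by [].
have wE : w = G x y / r by [].
(* The relations above are all that is used of the phase w and its conjugate. *)
clearbody w'; clearbody w r.
pose S := w *: delta_mx x y - w' *: delta_mx y x : 'M[R[i]]_N.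
have SE : S ^t* = - S.
  rewrite /S; apply/matrixP => i j; rewrite !mxE rmorphB !rmorphM /= !conjC_nat.
  by rewrite Cw Cw' opprB ![(_ == _) && (i == _)]andbC.
have yx : (y == x) = false by rewrite eq_sym; apply/negbTE.
have S2 : S *m S = - (delta_mx x x + delta_mx y y).
  rewrite /S !(mulmxBl, mulmxBr) -!scalemxAl -!scalemxAr !mul_delta_mx_cond.
  by rewrite yx (negbTE xy) !eqxx !mulr0n !mulr1n !scaler0 !scalerA ww mulrC ww
    !scale1r sub0r subr0 opprD.
have S3 : S *m S *m S = - S.
  rewrite S2 mulNmx /S !(mulmxDl, mulmxBr) -!scalemxAr !mul_delta_mx_cond.
  by rewrite yx (negbTE xy) !eqxx !mulr0n !mulr1n !scaler0 subr0 sub0r.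
have FS : mx_over F S.
  case: (F) FG => // FG' i j.
  have realE (z : R[i]) : z \is Num.real -> complex.Im z = 0.
    by case: z => a b; rewrite complex_real => /eqP.
  have realG k l : G k l \is Num.real.
    by move: (FG' k l); case: (G k l) => a b /= ->; rewrite complex_real.
  apply: realE; rewrite !mxE rpredB// rpredM ?realn//.
    by rewrite wE realM// realV.
  by rewrite w'E realM// realV.
have [g hg] := curve_commutator hG FS SE S3.
exists g, (S *m G - G *m S), (2 * Normc.normc (G x y)); split=> // [|z].
  by rewrite mulf_neq0// ?pnatr_eq0//; apply: contra Gxy => /eqP/Normc.eq0_normc ->.
have dl i j k l : (delta_mx i j *m G) k l = (k == i)%:R * G j l.
  rewrite mxE (bigD1 j)//= mxE eqxx andbT big1 ?addr0// => m /negbTE mj.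
  by rewrite mxE mj andbF mul0r.
have dr i j k l : (G *m delta_mx i j) k l = G k i * (l == j)%:R.
  rewrite mxE (bigD1 i)//= mxE eqxx big1 ?addr0// => m /negbTE mj.
  by rewrite mxE mj mulr0.
suff -> : (S *m G - G *m S) z z
    = (2 * Normc.normc (G x y) * ((z == x)%:R - (z == y)%:R))%:C by [].
have entE (A B C D : 'M[R[i]]_N) :
    (w *: A - w' *: B - (w *: C - w' *: D)) z z
    = w * A z z - w' * B z z - (w * C z z - w' * D z z) by rewrite !mxE.
rewrite /S mulmxBl mulmxBr -!scalemxAl -!scalemxAr entE !dl !dr.
rewrite !rmorphM rmorphB !rmorph_nat /= rN.
have [->|_] := eqVneq z x; first by rewrite (negbTE xy) /=; ring: wG w'G.
by have [->|_] := eqVneq z y => /=; [ring: wG w'G|ring].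
Qed.
End Grassmannian.

(** * Derivatives at a critical point *)

Section Calculus.
Variables (R : realType) (N : nat).

Lemma is_derive_unique (f : R -> R) (a b : R) :
  is_derive (0 : R) 1 f a -> is_derive (0 : R) 1 f b -> a = b.
Proof. by move=> [_ <-] [_ <-]. Qed.

(** Expanding the squares, the difference of the two functions of t is
    (b1 - b2) sum_x q_x (2 p_x + (b1 + b2) q_x).  Since
    q_x vanishes at 0, only 2 p_x q_x' survives in the derivative. *)
Lemma critical_affine_squares (psi : R -> R) (p q : 'I_N -> R -> R)
    (dp dq : 'I_N -> R) (b1 b2 : R) :
  (forall x, is_derive (0 : R) 1 (p x) (dp x)) ->
  (forall x, is_derive (0 : R) 1 (q x) (dq x)) ->
  (forall x, q x 0 = 0) ->
  b1 != b2 ->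
  is_derive (0 : R) 1 (fun t => psi t + \sum_x (p x t + b1 * q x t) ^+ 2) 0 ->
  is_derive (0 : R) 1 (fun t => psi t + \sum_x (p x t + b2 * q x t) ^+ 2) 0 ->
  \sum_x p x 0 * dq x = 0.
Proof.
move=> hp hq q0 b12 h1 h2.
pose f x : R -> R := q x * (2 \*: p x + (b1 + b2) \*: q x).
have hf x : is_derive (0 : R) 1 (f x) (2 * (p x 0 * dq x)).
  apply: is_derive_eq
    (is_deriveM (hq x) (is_deriveD (is_deriveZ 2 (hp x)) (is_deriveZ (b1 + b2) (hq x)))) _.
  rewrite -[LHS]/(q x 0 * (2 * dp x + (b1 + b2) * dq x)
    + (2 * p x 0 + (b1 + b2) * q x 0) * dq x).
  by rewrite q0; ring.
have hsum : is_derive (0 : R) 1 ((b1 - b2) \*: \sum_x f x) 0.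
  have := is_deriveB h1 h2; rewrite subr0; congr is_derive.
  apply/funext => t; rewrite !fctE /=.
  rewrite fct_sumE opprD addrACA subrr add0r -sumrB scaler_sumr.
  apply: eq_bigr => x _.
  rewrite -[RHS]/((b1 - b2) * (q x t * (2 * p x t + (b1 + b2) * q x t))).
  by ring.
have := is_derive_unique hsum (is_deriveZ (b1 - b2) (is_derive_sum hf)).
move/esym/eqP; rewrite -mulr_sumr !mulf_eq0 pnatr_eq0 /= subr_eq0 (negbTE b12).
by move=> /eqP.
Qed.

Lemma sqmodE (z : R[i]) : sqmod z = complex.Re z ^+ 2 + complex.Im z ^+ 2.
Proof.
by case: z => a b; rewrite /sqmod /= sqr_sqrtr// addr_ge0// sqr_ge0.
Qed.

Lemma is_derive_expR_comp (f : R -> R) (df x : R) : is_derive x 1 f df ->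
  is_derive x 1 (fun t => expR (f t)) (expR (f x) * df).
Proof.
move=> [/derivable1_diffP hf <-].
have he : differentiable expR (f x) by apply/derivable1_diffP/derivable_expR.
split; first exact/derivable1_diffP/differentiable_comp.
rewrite -!derive1E (@derive1_comp _ f expR) ?derive1E ?derive_val//.
exact/derivable1_diffP.
Qed.

Lemma is_derive_exp_sqmod (A : R -> 'M[R[i]]_N) X i j (a : R) :
  has_velocity A X ->
  is_derive (0 : R) 1 (fun t => expR (a * sqmod (A t i j)))
    (expR (a * sqmod (A 0 i j)) * (a * 2 *
      (complex.Re (A 0 i j) * complex.Re (X i j)
       + complex.Im (A 0 i j) * complex.Im (X i j)))).
Proof.
move=> hA; have hre := hA (i, j, false); have him := hA (i, j, true).
rewrite sqmodE; under eq_fun do rewrite sqmodE.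
pose f : R -> R := a \*: ((fun t => coord (A t) (i, j, false)) ^+ 2
  + (fun t => coord (A t) (i, j, true)) ^+ 2).
have hf := is_deriveZ a (is_deriveD (is_deriveX 2 hre) (is_deriveX 2 him)).
have := is_derive_expR_comp hf.
move/is_derive_eq; apply.
rewrite /f /coord /= /GRing.scale /= !fctE /=; ring.
Qed.
End Calculus.

(** * The chain potential *)

Section ChainPotential.
Variables (R : realType) (N : nat) (alpha : R).
Implicit Types (G H X : 'M[R[i]]_N) (x : 'I_N).

(** The part of the row sum potential that does not depend on beta. *)
Definition offdiag_sum H x : R :=
  alpha^-1 * \sum_(j < N | j != x) expR (alpha * sqmod (H x j)).

Definition offdiag_step H x : R := offdiag_sum H x - offdiag_sum H (ordS x).

Definition diag_step H x : R :=
  expR (sqmod (H x x)) - expR (sqmod (H (ordS x) (ordS x))).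

Lemma chain_potentialE beta H :
  chain_potential alpha beta H
  = \sum_x (offdiag_step H x + beta * diag_step H x) ^+ 2.
Proof.
apply: eq_bigr => x _; congr (_ ^+ 2).
by rewrite /row_sum /offdiag_step /diag_step /offdiag_sum; ring.
Qed.

(** Existence of the derivative suffices: the increments of these sums get
    multiplied by diagonal increments, which vanish at an equal-norm matrix. *)
Lemma derivable_offdiag_sum (A : R -> 'M[R[i]]_N) X x : has_velocity A X ->
  exists d, is_derive (0 : R) 1 (fun t => offdiag_sum (A t) x) d.
Proof.
move=> hA; pose f j t := if j != x then expR (alpha * sqmod (A t x j)) else 0.
have hf j : derivable (f j) 0 1.
  rewrite /f; case: (j != x); last exact: derivable_cst.
  by have [] := is_derive_exp_sqmod x j alpha hA.
have := is_deriveZ alpha^-1 (is_derive_sum (fun j => derivableP (hf j))).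
set d := _ *: _ => hd; exists d; move: hd; congr is_derive.
apply/funext => t; rewrite -[LHS]/(alpha^-1 * (\sum_j f j) t) fct_sumE.
by rewrite /offdiag_sum [in RHS]big_mkcond.
Qed.

Lemma is_derive_exp_diag (A : R -> 'M[R[i]]_N) X x : has_velocity A X ->
  complex.Im (A 0 x x) = 0 ->
  is_derive (0 : R) 1 (fun t => expR (sqmod (A t x x)))
    (expR (sqmod (A 0 x x)) * (2 * complex.Re (A 0 x x)) * complex.Re (X x x)).
Proof.
move=> hA im0; have := is_derive_exp_sqmod x x 1 hA.
under eq_fun do rewrite mul1r.
by move/is_derive_eq; apply; rewrite im0 !mul1r; ring.
Qed.

(** The derivative of [diag_step] along the curve is the diagonal increment of the
    velocity times the constant k = 2 m exp (m ^ 2), which is nonzero because the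
    common diagonal entry m is. *)
Lemma critical_along_curve M (Psi : 'M[R[i]]_N -> R) G g X b1 b2 m : b1 != b2 ->
  (forall b, b = b1 \/ b = b2 ->
     is_gradient M (fun H => Psi H + chain_potential alpha b H) G 0) ->
  curve_with_velocity M G g X -> (forall x, G x x = m%:C) -> m != 0 ->
  \sum_x offdiag_step G x
    * (complex.Re (X x x) - complex.Re (X (ordS x) (ordS x))) = 0.
Proof.
move=> b12 hgrad hg Gm m0; have [g0 _ hX] := hg.
have hX' : has_velocity g X := hX.
pose k := expR (sqmod m%:C) * (2 * m).
have k0 : k != 0 by rewrite mulf_neq0 ?mulf_neq0 ?pnatr_eq0// gt_eqF ?expR_gt0.
have hq x : is_derive (0 : R) 1 (fun t => diag_step (g t) x)
    (k * (complex.Re (X x x) - complex.Re (X (ordS x) (ordS x)))).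
  have hd y : is_derive (0 : R) 1 (fun t => expR (sqmod (g t y y)))
      (k * complex.Re (X y y)).
    by have := is_derive_exp_diag (x := y) hX'; rewrite g0 Gm; exact.
  by rewrite mulrBr; exact: is_deriveB (hd x) (hd (ordS x)).
have [dA hA] := choice (fun x => derivable_offdiag_sum x hX').
have hp x : is_derive (0 : R) 1 (fun t => offdiag_step (g t) x)
    (dA x - dA (ordS x)) := is_deriveB (hA x) (hA (ordS x)).
have crit b : b = b1 \/ b = b2 -> is_derive (0 : R) 1 (fun t => Psi (g t)
    + \sum_x (offdiag_step (g t) x + b * diag_step (g t) x) ^+ 2) 0.
  move=> /hgrad[_ /(_ _ _ hg)]; rewrite /riem_metric mul0mx mxtrace0.
  by congr is_derive; apply/funext => t; rewrite chain_potentialE.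
have := critical_affine_squares hp hq _ b12 (crit _ (or_introl erefl))
  (crit _ (or_intror erefl)).
rewrite g0 => /(_ _)/eqP.
rewrite (eq_bigr (fun x => k * (offdiag_step G x
    * (complex.Re (X x x) - complex.Re (X (ordS x) (ordS x)))))); last first.
  by move=> x _; ring.
rewrite -mulr_sumr mulf_eq0 (negbTE k0) /= => h; apply/eqP; apply: h => x.
by rewrite /diag_step !Gm subrr.
Qed.

End ChainPotential.

(** Summation by parts: testing increments of the indicators of x and y against f
    gives the backward increments of f at x and y. *)
Lemma sum_pair_diff (R : comPzRingType) (N : nat) (f : 'I_N -> R) (x y : 'I_N) :
  \sum_z f z * ((z == x)%:R - (z == y)%:R
    - ((ordS z == x)%:R - (ordS z == y)%:R))
  = f x - f (ord_pred x) - (f y - f (ord_pred y)).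
Proof.
have pick a : \sum_z f z * (z == a)%:R = f a.
  rewrite (bigD1 a)//= eqxx mulr1 big1 ?addr0// => z /negbTE ->.
  by rewrite mulr0.
have pickS a : \sum_z f z * (ordS z == a)%:R = f (ord_pred a).
  rewrite -pick; apply: eq_bigr => z _.
  by rewrite (can2_eq (@ordSK N) (@ord_predK N)).
under eq_bigr do rewrite !mulrBr.
by rewrite !sumrB !pick !pickS; ring.
Qed.

Theorem proposition4p20 (R : realType) (F : base_field) (N K : nat)
    (hKN : (1 <= K <= N)%N)
    (Psi : 'M[R[i]]_N -> R)
    (Psi_ge0 : forall H, grassmannian F K H -> 0 <= Psi H)
    (Psi_analytic : real_analytic_on (grassmannian F K) Psi)
    (G : 'M[R[i]]_N) (hG : grassmannian F K G)
    (G_equal_norm : equal_norm G)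
    (G_neq0 : forall i j, G i j != 0)
    (alpha : R) (alpha_gt0 : 0 < alpha)
    (J : set R) (J_open : open J) (J_itv : is_interval J)
    (J_nonempty : J !=set0) (J_gt0 : forall beta, J beta -> 0 < beta)
    (hgrad : forall beta, J beta ->
       is_gradient (grassmannian F K)
         (fun H => Psi H + chain_potential alpha beta H) G 0) :
  equipartitioned alpha G.
Proof.
have [b1 [b2 [b12 hJ]]] : exists b1 b2, b1 != b2 /\
    forall b, b = b1 \/ b = b2 -> J b.
  have [b Jb] := J_nonempty.
  have /nbhs_ballP[e /= e0 be] := open_nbhs_nbhs (conj J_open Jb).
  exists b, (b + e / 2); split.
    by rewrite eq_sym -subr_eq0 addrAC subrr add0r gt_eqF// divr_gt0.
  move=> _ [->//|->]; apply: be; rewrite /ball /= opprD addNKr normrN gtr0_norm.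
    by rewrite ltr_pdivrMr// ltr_pMr// ltr1n.
  exact: divr_gt0.
have Gxx x : G x x = (complex.Re (G x x))%:C.
  have [_ _ GE _] := hG; apply/esym/RRe_real/CrealP.
  by rewrite [in RHS]GE !mxE.
have pconst : forall x y, offdiag_step alpha G x = offdiag_step alpha G y.
  (* Rotating in the plane of x+1 and y+1 compares the backward increments of p
     there, that is, its forward increments at x and y. *)
  apply: const_of_cyclic_diff => x y; have [->//|xy] := eqVneq x y.
  have Sxy : ordS x != ordS y by rewrite (inj_eq (@ordS_inj N)).
  have [g [X [c [c0 hg Xd]]]] := pair_rotation hG Sxy (G_neq0 _ _).
  have m0 : complex.Re (G x x) != 0.
    by apply: contra (G_neq0 x x) => /eqP h; rewrite Gxx h.
  have := critical_along_curve b12 (fun b hb => hgrad b (hJ b hb)) hg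
    (fun z => etrans (G_equal_norm z x) (Gxx x)) m0.
  under eq_bigr do rewrite !Xd -mulrBr mulrCA.
  rewrite -mulr_sumr sum_pair_diff !ordSK => /eqP.
  rewrite mulf_eq0 (negbTE c0) /= subr_eq0 => /eqP h.
  by rewrite -opprB h opprB.
have Aconst : forall x y, offdiag_sum alpha G x = offdiag_sum alpha G y.
  exact: const_of_cyclic_diff.
move=> x y; rewrite (bigD1 x)//= [RHS](bigD1 y)//= (G_equal_norm x y).
by congr (_ + _); apply: (mulfI (invr_neq0 (lt0r_neq0 alpha_gt0))); exact: Aconst.
Qed.
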